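(* Let $X$ and $Y$ be path connected topological spaces, let $G$ be a group acting from the left on $X$ by homeomorphisms, and let $H$ be a finite group of order $m$ acting from the left on $Y$ by homeomorphisms. Suppose that the action of $G$ on $X$ is weakly discontinuous at a point $x\in X$ and the action of $H$ on $Y$ is weakly discontinuous at a point $y\in Y$. Let $W=\mathrm{Map}(H,X)\times Y\cong X^m\times Y$ with the natural action of $G\wr H$, and let $w=(\mathbf{x},y)\in W$, where $\mathbf{x}\colon H\to X$ is the constant map into $x$ (so that the action of $G\wr H$ is weakly discontinuous at $w$). Then the short exact sequence of $(W,(G\wr H)w,w)$ $$\pi_1(W,w)\hookrightarrow \pi_1\bigl(W,(G\wr H)w,w\bigr)\twoheadrightarrow G\wr H$$ is isomorphic to the short exact sequence $$\bigl(\pi_1(X,x)\bigr)^m\times\pi_1(Y,y)\hookrightarrow \pi_1(X,Gx,x)\wr_{\delta_Y}\pi_1(Y,Hy,y)\xrightarrow{\ \delta_X\wr\delta_Y\ }\!\!\!\!\to G\wr H,$$ where the first arrow is $(a_1,\dots,a_m,b)\mapsto(j_X(a_1),\dots,j_X(a_m),j_Y(b))$ and $(\delta_X\wr\delta_Y)(a_1,\dots,a_m,b)=(\delta_X(a_1),\dots,\delta_X(a_m),\delta_Y(b))$. In particular, there is an isomorphism $$\pi_1\bigl(W,(G\wr H)w,w\bigr)\cong \pi_1(X,Gx,x)\wr_{\delta_Y}\pi_1(Y,Hy,y).$$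
   Context: Weakly discontinuous (WD) at $x$: an action of a group $G$ by homeomorphisms on a space $X$ is WD at $x\in X$ if the stabilizer of $x$ is trivial and the path component of $x$ in its orbit $Gx$ (subspace topology) is $\{x\}$ (equivalently, every continuous path in $Gx$ is constant and the stabilizer of $x$ is trivial). Group $\pi_1(X,Gx,x)$: for $X$ path connected and a $G$-action WD at $x$, $\pi_1(X,Gx,x)$ is the set of homotopy classes of paths $\alpha\colon[0,1]\to X$ with $\alpha(0)=x$, $\alpha(1)\in Gx$ (homotopies through such paths). Let $\delta_X([\alpha])\in G$ be the unique $g$ with $\alpha(1)=gx$. The group operation is $[\alpha]\cdot[\beta]=[\alpha\,\sharp\,(\delta_X(\alpha)\circ\beta)]$, where $\sharp$ is the usual concatenation of paths (first $\alpha$) and $\delta_X(\alpha)\circ\beta$ is the translate of $\beta$ by $\delta_X(\alpha)\in G$. The short exact sequence of $(X,Gx,x)$ is $\pi_1(X,x)\xrightarrow{j_X}\pi_1(X,Gx,x)\xrightarrow{\delta_X}G$, where $j_X$ regards a loop at $x$ as a path from $x$ to $Gx$. The same notation ($j_Y,\delta_Y$) is used for $(Y,Hy,y)$, and the same construction is used for $(W,(G\wr H)w,w)$. Wreath products: $\mathrm{Map}(S,G)$ is the set of all maps $S\to G$, a group under pointwise multiplication when $G$ is a group. For $h$ in a group $\mathsf X$ let $R_h(k)=kh$. For a homomorphism $\delta\colon K\to \mathsf X$, $G\wr_\delta K$ is the set $\mathrm{Map}(\mathsf X,G)\times K$ with multiplication $(\alpha,k)(\beta,l)=(\alpha\cdot(\beta\circ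 R_{\delta(k)}),kl)$; $G\wr H:=G\wr_{\mathrm{id}_H}H$. Since $H$ is finite of order $m$, after enumerating $H$ one identifies $\mathrm{Map}(H,A)$ with $A^m$; in particular elements of $\pi_1(X,Gx,x)\wr_{\delta_Y}\pi_1(Y,Hy,y)$ are written $(a_1,\dots,a_m,b)$. $\mathrm{Map}(H,X)\cong X^m$ carries the product topology. Natural action of $G\wr H$ on $W$: $(\phi,h)\bullet(\alpha,y')=(\phi\cdot(\alpha\circ R_h),hy')$, where $(\phi\cdot(\alpha\circ R_h))(k)=\phi(k)\alpha(kh)$. Two short exact sequences are isomorphic if there are isomorphisms between corresponding terms making the resulting diagram commute. *)

(* Defs.v *)
From HB Require Import structures.
From mathcomp Require Import all_boot all_order all_algebra all_fingroup.
From mathcomp Require Import generic_quotient.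
From mathcomp Require Import all_classical all_reals all_analysis.
From mathcomp Require Import ring lra.

Set SsrOldRewriteGoalsOrder.
Set Implicit Arguments.
Unset Strict Implicit.
Unset Printing Implicit Defensive.

Import Order.TTheory GRing.Theory Num.Theory.
Import numFieldNormedType.Exports.

Local Open Scope classical_set_scope.
Local Open Scope quotient_scope.
Local Open Scope ring_scope.

Definition unit_itv (R : realType) : set R := `[0, 1].
Arguments unit_itv R : clear implicits.
Definition unit_square (R : realType) : set (R * R) :=
  unit_itv R `*` unit_itv R.
Arguments unit_square R : clear implicits.

(* Paths are total functions R -> X of which only the restriction to [0, 1]
   matters; functions that agree on [0, 1] are homotopic, hence identified in
   the quotient homotopy_class. *)
Definition is_path_to (R : realType) (X : topologicalType) (x : X) (A : set X)
    (f : R -> X) : Prop :=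
  [/\ {within unit_itv R, continuous f}, f 0 = x & A (f 1)].

Definition path_connected (R : realType) (X : topologicalType) : Prop :=
  forall a b : X, exists f : R -> X, is_path_to a [set b] f.

(* The path component of x in the subspace A: a path in A is a path in X with
   image in A. *)
Definition path_component (R : realType) (X : topologicalType) (A : set X)
    (x : X) : set X :=
  [set z | exists2 f : R -> X, is_path_to x [set z] f & f @` unit_itv R `<=` A].

(* Homotopy through paths from x to A; t = u.1 is the path parameter and
   s = u.2 the homotopy parameter. *)
Definition path_homotopic (R : realType) (X : topologicalType) (x : X)
    (A : set X) (f g : R -> X) : Prop :=
  exists F : R * R -> X,
    [/\ {within unit_square R, continuous F},
        forall t, unit_itv R t -> F (t, 0) = f t,
        forall t, unit_itv R t -> F (t, 1) = g t,
        forall s, unit_itv R s -> F (0, s) = x &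
        forall s, unit_itv R s -> A (F (1, s))].

Definition path_concat (R : realType) (X : Type) (f g : R -> X) : R -> X :=
  fun t => if t <= 2^-1 then f (2 * t) else g (2 * t - 1).

Definition path_rev (R : realType) (X : Type) (f : R -> X) : R -> X :=
  fun t => f (1 - t).

Section paste.
Context {T U : topologicalType}.

Lemma within_comp (S : topologicalType) (A : set T) (B : set S) (p : T -> S)
    (F : S -> U) :
  continuous p -> (forall t, A t -> B (p t)) ->
  {within B, continuous F} -> {within A, continuous (F \o p)}.
Proof.
move=> cp pAB /subspace_continuousP cF.
apply/subspace_continuousP => t At.
apply: (cvg_trans _ (cF _ (pAB _ At))).
move=> W /=; rewrite /within /= => nW.
have := cp t _ nW; rewrite /= /nbhs /=.
by apply: filterS => z /= + Az; apply; exact: pAB.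
Qed.

Lemma within_paste (A B : set T) (f g h : T -> U) : closed A -> closed B ->
  {within A, continuous f} -> {within B, continuous g} ->
  (forall t, A t -> h t = f t) -> (forall t, B t -> h t = g t) ->
  {within A `|` B, continuous h}.
Proof.
move=> cA cB cf cg hf hg; apply: withinU_continuous => //.
  by apply: subspace_eq_continuous cf => t /set_mem At; exact/esym/hf.
by apply: subspace_eq_continuous cg => t /set_mem At; exact/esym/hg.
Qed.

End paste.

Section homotopy.
Context {R : realType} {X : topologicalType}.
Implicit Types (x y : X) (A : set X) (f g h : R -> X).
Local Notation I := (unit_itv R).
Local Notation I2 := (unit_square R).

Lemma unit_itvP (t : R) : I t <-> 0 <= t <= 1.
Proof. by rewrite /unit_itv /= in_itv. Qed.

Let I0 : I 0. Proof. by apply/unit_itvP; rewrite lexx ler01. Qed.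
Let I1 : I 1. Proof. by apply/unit_itvP; rewrite lexx ler01. Qed.

Lemma fst_cont (S1 S2 : topologicalType) : continuous (@fst S1 S2).
Proof. by move=> u; exact: cvg_fst. Qed.
Arguments fst_cont : clear implicits.

Lemma snd_cont (S1 S2 : topologicalType) : continuous (@snd S1 S2).
Proof. by move=> u; exact: cvg_snd. Qed.
Arguments snd_cont : clear implicits.

Lemma affine_cont (T : topologicalType) (p : T -> R) (a b : R) :
  continuous p -> continuous (fun t => a * p t + b).
Proof.
move=> cp t; apply: cvgD; last exact: cvg_cst.
by apply: cvgM; [exact: cvg_cst|exact: cp].
Qed.

Lemma pair_cont (T S1 S2 : topologicalType) (p : T -> S1) (q : T -> S2) :
  continuous p -> continuous q -> continuous (fun t => (p t, q t)).
Proof. by move=> cp cq t; apply: cvg_pair; [exact: cp|exact: cq]. Qed.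

Lemma closed_le_cont (T : topologicalType) (p q : T -> R) :
  continuous p -> continuous q -> closed [set t | p t <= q t].
Proof.
move=> cp cq.
rewrite (_ : [set t | _] = (fun t => q t - p t) @^-1` [set r | 0 <= r]).
  apply: closed_comp; last exact: closed_ge.
  by move=> t _; apply: cvgB; [exact: cq|exact: cp].
by apply/seteqP; split => t /=; rewrite subr_ge0.
Qed.

Lemma closed_I : closed I.
Proof. exact: interval_closed. Qed.

Lemma closed_I2 : closed I2.
Proof.
rewrite (_ : I2 = (fun u : R * R => u.1) @^-1` I `&`
  (fun u : R * R => u.2) @^-1` I); last by apply/seteqP; split => -[].
by apply: closedI; apply: closed_comp closed_I => u _;
  [exact (@fst_cont _ _ u)|exact (@snd_cont _ _ u)].
Qed.

Lemma path_homotopicS x A B f g : A `<=` B ->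
  path_homotopic x A f g -> path_homotopic x B f g.
Proof. by move=> AB [F [? ? ? ? FA]]; exists F; split => // s /FA/AB. Qed.

Lemma path_homotopic_eq x A f g f' g' :
  (forall t, I t -> f t = f' t) -> (forall t, I t -> g t = g' t) ->
  path_homotopic x A f g -> path_homotopic x A f' g'.
Proof.
move=> ff gg [F [? F0 F1 ? ?]]; exists F; split => // t It.
  by rewrite -ff // F0.
by rewrite -gg // F1.
Qed.

Lemma path_homotopic_refl x A f : is_path_to x A f -> path_homotopic x A f f.
Proof.
move=> [cf f0 f1]; exists (f \o fst); split => //.
by apply: (within_comp _ _ cf) => [|[t s] [//]]; exact (@fst_cont _ _).
Qed.

Lemma path_homotopic_sym x A f g :
  path_homotopic x A f g -> path_homotopic x A g f.
Proof.
move=> [F [cF F0 F1 Fx FA]].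
have I1B s : I s -> I (-1 * s + 1) by rewrite !unit_itvP => ?; lra.
exists (F \o (fun u => (u.1, -1 * u.2 + 1))); split => /=.
- apply: (within_comp _ _ cF) => [|[t s] [/= It Is]]; last first.
    by split => //=; exact: I1B.
  by apply: pair_cont; [exact (@fst_cont _ _)|exact (affine_cont (@snd_cont _ _))].
- by move=> t It; rewrite mulr0 add0r F1.
- by move=> t It; rewrite mulr1 addNr F0.
- by move=> s /I1B /Fx.
- by move=> s /I1B /FA.
Qed.

Lemma path_homotopic_trans x A f g h :
  path_homotopic x A f g -> path_homotopic x A g h -> path_homotopic x A f h.
Proof.
move=> [F [cF F0 F1 Fx FA]] [G [cG G0 G1 Gx GA]].
pose K (u : R * R) := if u.2 <= 2^-1 then F (u.1, 2 * u.2 + 0)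
                      else G (u.1, 2 * u.2 + -1).
have Ilo s : I s -> s <= 2^-1 -> I (2 * s + 0) by rewrite !unit_itvP => ? ?; lra.
have Ihi s : I s -> 2^-1 <= s -> I (2 * s + -1)
  by rewrite !unit_itvP => ? ?; lra.
exists K; split.
- have -> : I2 = (I2 `&` [set u | u.2 <= 2^-1]) `|`
                 (I2 `&` [set u | 2^-1 <= u.2]).
    rewrite -setIUr; apply/seteqP; split => [u Iu|u []//]; split => //=.
    by have [?|/ltW ?] := leP u.2 2^-1; [left|right].
  apply: (@within_paste _ _ _ _ (F \o (fun u => (u.1, 2 * u.2 + 0)))
                        (G \o (fun u => (u.1, 2 * u.2 + -1)))).
  + by apply: closedI closed_I2 _; apply: closed_le_cont (@snd_cont _ _) _ => u;
      exact: cvg_cst.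
  + by apply: closedI closed_I2 _; apply: closed_le_cont _ (@snd_cont _ _) => u;
      exact: cvg_cst.
  + apply: (within_comp _ _ cF) => [|[t s] [[/= It Is] ?]].
      by apply: pair_cont; [exact (@fst_cont _ _)|exact (affine_cont (@snd_cont _ _))].
    by split => //=; exact: Ilo.
  + apply: (within_comp _ _ cG) => [|[t s] [[/= It Is] ?]].
      by apply: pair_cont; [exact (@fst_cont _ _)|exact (affine_cont (@snd_cont _ _))].
    by split => //=; exact: Ihi.
  + by move=> u [_ /= us]; rewrite /K us.
  + move=> [t s] [[/= It _] us]; rewrite /K /=; case: ifPn => // sl.
    have -> : s = 2^-1 by apply/eqP; rewrite eq_le sl us.
    have -> : 2 * 2^-1 + 0 = 1 :> R by lra.
    have -> : 2 * 2^-1 + -1 = 0 :> R by lra.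
    by rewrite F1 // G0.
- by move=> t It; rewrite /K /= ifT ?mulr0 ?add0r ?F0 // invr_ge0.
- move=> t It; rewrite /K /= ifF; last by apply/negbTE; rewrite -ltNge; lra.
  have -> : 2 * 1 + -1 = 1 :> R by lra.
  by rewrite G1.
- move=> s Is; rewrite /K /=; case: (leP s 2^-1) => [?|/ltW ?].
    by rewrite Fx //; exact: Ilo.
  by rewrite Gx //; exact: Ihi.
- move=> s Is; rewrite /K /=; case: (leP s 2^-1) => [?|/ltW ?].
    by apply/FA/Ilo.
  by apply/GA/Ihi.
Qed.

Lemma path_homotopic_concat x y A f f' g g' :
  path_homotopic x [set y] f f' -> path_homotopic y A g g' ->
  path_homotopic x A (path_concat f g) (path_concat f' g').
Proof.
move=> [F [cF F0 F1 Fx Fy]] [G [cG G0 G1 Gy GA]].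
pose K (u : R * R) := if u.1 <= 2^-1 then F (2 * u.1 + 0, u.2)
                      else G (2 * u.1 + -1, u.2).
have Ilo s : I s -> s <= 2^-1 -> I (2 * s + 0) by rewrite !unit_itvP => ? ?; lra.
have Ihi s : I s -> 2^-1 <= s -> I (2 * s + -1)
  by rewrite !unit_itvP => ? ?; lra.
exists K; split.
- have -> : I2 = (I2 `&` [set u | u.1 <= 2^-1]) `|`
                 (I2 `&` [set u | 2^-1 <= u.1]).
    rewrite -setIUr; apply/seteqP; split => [u Iu|u []//]; split => //=.
    by have [?|/ltW ?] := leP u.1 2^-1; [left|right].
  apply: (@within_paste _ _ _ _ (F \o (fun u => (2 * u.1 + 0, u.2)))
                        (G \o (fun u => (2 * u.1 + -1, u.2)))).
  + by apply: closedI closed_I2 _; apply: closed_le_cont (@fst_cont _ _) _ => u;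
      exact: cvg_cst.
  + by apply: closedI closed_I2 _; apply: closed_le_cont _ (@fst_cont _ _) => u;
      exact: cvg_cst.
  + apply: (within_comp _ _ cF) => [|[t s] [[/= It Is] ?]].
      by apply: pair_cont; [exact (affine_cont (@fst_cont _ _))|exact (@snd_cont _ _)].
    by split => //=; exact: Ilo.
  + apply: (within_comp _ _ cG) => [|[t s] [[/= It Is] ?]].
      by apply: pair_cont; [exact (affine_cont (@fst_cont _ _))|exact (@snd_cont _ _)].
    by split => //=; exact: Ihi.
  + by move=> u [_ /= us]; rewrite /K us.
  + move=> [t s] [[/= _ Is] us]; rewrite /K /=; case: ifPn => // sl.
    have -> : t = 2^-1 by apply/eqP; rewrite eq_le sl us.
    have -> : 2 * 2^-1 + 0 = 1 :> R by lra.
    have -> : 2 * 2^-1 + -1 = 0 :> R by lra.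
    by rewrite Gy // Fy.
- move=> t It; rewrite /K /path_concat /=; case: (leP t 2^-1) => [?|/ltW ?].
    by rewrite F0 ?addr0 //; rewrite -[2 * t]addr0; exact: Ilo.
  by rewrite G0 //; exact: Ihi.
- move=> t It; rewrite /K /path_concat /=; case: (leP t 2^-1) => [?|/ltW ?].
    by rewrite F1 ?addr0 //; rewrite -[2 * t]addr0; exact: Ilo.
  by rewrite G1 //; exact: Ihi.
- by move=> s Is; rewrite /K /= ifT ?mulr0 ?add0r ?Fx // invr_ge0.
- move=> s Is; rewrite /K /= ifF; last by apply/negbTE; rewrite -ltNge; lra.
  have -> : 2 * 1 + -1 = 1 :> R by lra.
  by apply: GA.
Qed.

Lemma path_homotopic_reparam x A f (p q : R -> R) :
  {within I, continuous f} -> continuous p -> continuous q ->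
  (forall t, I t -> I (p t)) -> (forall t, I t -> I (q t)) ->
  p 0 = q 0 -> p 1 = q 1 -> f (p 0) = x -> A (f (p 1)) ->
  path_homotopic x A (f \o p) (f \o q).
Proof.
move=> cf cp cq pI qI pq0 pq1 fx fA.
exists (f \o (fun u => (1 - u.2) * p u.1 + u.2 * q u.1)); split => /=.
- apply: (within_comp _ _ cf) => [u|[t s] /= [It Is]].
    apply: cvgD; apply: cvgM.
    + by apply: cvgB; [exact: cvg_cst|exact (@snd_cont _ _ u)].
    + by apply: (@continuous_comp _ _ _ fst p); [exact (@fst_cont _ _ u)|exact: cp].
    + exact (@snd_cont _ _ u).
    + by apply: (@continuous_comp _ _ _ fst q); [exact (@fst_cont _ _ u)|exact: cq].
  move: (pI _ It) (qI _ It) Is; rewrite !unit_itvP /=.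
  by move=> /andP[? ?] /andP[? ?] /andP[? ?]; apply/andP; split; nra.
- by move=> t _; rewrite subr0 mul1r mul0r addr0.
- by move=> t _; rewrite subrr mul1r mul0r add0r.
- by move=> s _; rewrite -pq0 -mulrDl subrK mul1r.
- by move=> s _; rewrite -pq1 -mulrDl subrK mul1r.
Qed.

Lemma is_path_concat x y A f g : is_path_to x [set y] f -> is_path_to y A g ->
  is_path_to x A (path_concat f g).
Proof.
move=> [cf f0 f1] [cg g0 g1]; split.
- have -> : I = (I `&` [set u | u <= 2^-1]) `|` (I `&` [set u | 2^-1 <= u]).
    rewrite -setIUr; apply/seteqP; split => [u Iu|u []//]; split => //=.
    by have [?|/ltW ?] := leP u 2^-1; [left|right].
  have cid : continuous (fun t : R => t) by move=> t; exact: cvg_id.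
  apply: (@within_paste _ _ _ _ (f \o (fun t => 2 * t + 0))
                        (g \o (fun t => 2 * t + -1))).
  + by apply: closedI closed_I _; apply: closed_le_cont cid _ => u;
      exact: cvg_cst.
  + by apply: closedI closed_I _; apply: closed_le_cont _ cid => u;
      exact: cvg_cst.
  + apply: (within_comp _ _ cf) => [|t [/=]]; first exact: affine_cont.
    by rewrite !unit_itvP => ? ?; lra.
  + apply: (within_comp _ _ cg) => [|t [/=]]; first exact: affine_cont.
    by rewrite !unit_itvP => ? ?; lra.
  + by move=> u [_ /= us]; rewrite /path_concat us addr0.
  + move=> t [/= _ us]; rewrite /path_concat /=; case: ifPn => // sl.
    have -> : t = 2^-1 by apply/eqP; rewrite eq_le sl us.
    have -> : 2 * 2^-1 = 1 :> R by lra.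
    by rewrite subrr g0.
- by rewrite /path_concat ifT ?mulr0 // invr_ge0.
- rewrite /path_concat ifF; last by apply/negbTE; rewrite -ltNge; lra.
  by have -> : 2 * 1 - 1 = 1 :> R by lra.
Qed.

Lemma is_path_rev x y f : is_path_to x [set y] f -> is_path_to y [set x] (path_rev f).
Proof.
move=> [cf f0 f1]; split; rewrite /path_rev ?subr0 ?subrr //.
apply: (within_comp _ _ cf) => [t|t]; last by rewrite !unit_itvP => ?; lra.
by apply: cvgB; [exact: cvg_cst|exact: cvg_id].
Qed.

Lemma is_path_cst x A : A x -> @is_path_to R X x A (cst x).
Proof. by split => //; apply: continuous_subspaceT => ?; exact: cvg_cst. Qed.

Lemma path_homotopic_rev x y f g : path_homotopic x [set y] f g ->
  path_homotopic y [set x] (path_rev f) (path_rev g).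
Proof.
move=> [F [cF F0 F1 Fx FA]].
have I1B s : I s -> I (1 - s) by rewrite !unit_itvP => ?; lra.
exists (F \o (fun u => (1 - u.1, u.2))); split => /=.
- apply: (within_comp _ _ cF) => [|[t s] [/= It Is]]; last first.
    by split => //=; exact: I1B.
  apply: pair_cont; last exact (@snd_cont _ _).
  by move=> u; apply: cvgB; [exact: cvg_cst|exact (@fst_cont _ _ u)].
- by move=> t /I1B; exact: F0.
- by move=> t /I1B; exact: F1.
- by move=> s Is; rewrite subr0; exact: FA.
- by move=> s Is; rewrite subrr; exact: Fx.
Qed.

Let minc (p q : R -> R) : continuous p -> continuous q ->
  continuous (fun t => Num.min (p t) (q t)).
Proof. by move=> cp cq t; apply: continuous_min; [exact: cp|exact: cq]. Qed.

Let maxc (p q : R -> R) : continuous p -> continuous q ->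
  continuous (fun t => Num.max (p t) (q t)).
Proof. by move=> cp cq t; apply: continuous_max; [exact: cp|exact: cq]. Qed.

Let idc : continuous (fun t : R => t). Proof. by move=> t; exact: cvg_id. Qed.
Let cstc (a : R) : continuous (fun t : R => a).
Proof. by move=> t; exact: cvg_cst. Qed.

Lemma path_concatA x y z A f g h :
  is_path_to x [set y] f -> is_path_to y [set z] g -> is_path_to z A h ->
  path_homotopic x A (path_concat f (path_concat g h))
                     (path_concat (path_concat f g) h).
Proof.
move=> pf pg ph.
have pgh := is_path_concat pg ph.
have [cp p0 p1] := is_path_concat pf pgh.
pose q (t : R) := Num.min (2 * t + 0) (Num.min (1 * t + 4^-1) (2^-1 * t + 2^-1)).
have q0 : q 0 = 0.
  rewrite /q !mulr0 !add0r (min_idPl _) // le_min !invr_ge0 /= !ler0n //.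
have q1 : q 1 = 1.
  rewrite /q (@min_r _ _ (1 * 1 + 4^-1)); last by lra.
  by rewrite min_r; lra.
set pp := path_concat f _ in cp p0 p1 *.
apply: (@path_homotopic_eq _ _ (pp \o id) (pp \o q)) => //; last first.
  apply: path_homotopic_reparam => //=.
  - by do !apply: minc; apply: affine_cont.
  - move=> t; rewrite !unit_itvP /q => /andP[t0 t1].
    by rewrite !(le_min, ge_min); apply/andP; split; [lra|apply/orP; right; lra].
have [_ f0 f1] := pf; have [_ g0 g1] := pg; have [_ h0 h1] := ph.
move=> t /unit_itvP /andP[t0 t1] /=; rewrite /q.
rewrite /pp /path_concat.
have [t4|t4] := leP t 4^-1.
  rewrite min_l; last by rewrite le_min; apply/andP; split; lra.
  rewrite (_ : 2 * t + 0 <= 2^-1); last by lra.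
  rewrite (_ : t <= 2^-1); last by lra.
  rewrite (_ : 2 * t <= 2^-1); last by lra.
  by rewrite addr0.
have [t2|t2] := leP t 2^-1.
  rewrite (@min_l _ _ (1 * t + 4^-1)); last by lra.
  rewrite min_r; last by lra.
  rewrite ifF; last by apply/negbTE; rewrite -ltNge; lra.
  rewrite ifT; last by lra.
  rewrite ifF; last by apply/negbTE; rewrite -ltNge; lra.
  by congr g; lra.
rewrite (@min_r _ _ (1 * t + 4^-1)); last by lra.
rewrite min_r; last by lra.
rewrite ifF; last by apply/negbTE; rewrite -ltNge; lra.
rewrite ifF; last by apply/negbTE; rewrite -ltNge; lra.
by congr h; lra.
Qed.

Lemma path_concat_cstl x A f : is_path_to x A f ->
  path_homotopic x A (path_concat (cst x) f) f.
Proof.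
move=> [cf f0 f1].
apply: (@path_homotopic_eq _ _ (f \o (fun t => Num.max 0 (2 * t + -1))) (f \o id))
    => //; last first.
  apply: path_homotopic_reparam => //=.
  - by apply: maxc => //; apply: affine_cont.
  - move=> t; rewrite !unit_itvP => /andP[t0 t1].
    by rewrite !(ge_max, le_max) lexx /=; apply/andP; split; lra.
  - by rewrite max_l //; lra.
  - by rewrite max_r //; lra.
  - by rewrite max_l //; lra.
  - by rewrite max_r; [have -> : 2 * 1 + -1 = 1 :> R by lra|lra].
move=> t It; rewrite /path_concat /=; case: leP => ht.
  by rewrite max_l //; lra.
by rewrite max_r //; lra.
Qed.

Lemma path_concat_cstr x y f : is_path_to x [set y] f ->
  path_homotopic x [set y] (path_concat f (cst y)) f.
Proof.
move=> [cf f0 f1].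
apply: (@path_homotopic_eq _ _ (f \o (fun t => Num.min 1 (2 * t + 0))) (f \o id))
    => //; last first.
  apply: path_homotopic_reparam => //=.
  - by apply: minc => //; apply: affine_cont.
  - move=> t; rewrite !unit_itvP => /andP[t0 t1].
    by rewrite le_min ge_min lexx ler01 /= andbT; lra.
  - by rewrite min_r //; lra.
  - by rewrite min_l //; lra.
  - by rewrite min_r; [have -> : 2 * 0 + 0 = 0 :> R by lra|lra].
  - by rewrite min_l; [|lra].
move=> t It; rewrite /path_concat /=; case: leP => ht.
  by rewrite min_r; [rewrite addr0|lra].
by rewrite min_l; [exact: f1|lra].
Qed.

Lemma path_concat_revr x y f : is_path_to x [set y] f ->
  path_homotopic x [set x] (path_concat f (path_rev f)) (cst x).
Proof.
move=> [cf f0 f1].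
apply: (@path_homotopic_eq _ _
    (f \o (fun t => Num.min (2 * t + 0) (-2 * t + 2))) (f \o cst 0)); last first.
- apply: path_homotopic_reparam => //=.
  + by apply: minc => //; apply: affine_cont.
  + exact: cstc.
  + move=> t; rewrite !unit_itvP => /andP[t0 t1].
    rewrite !(ge_min, le_min); apply/andP; split; first by apply/andP; split; lra.
    by have [?|?] := leP t 2^-1; apply/orP; [left|right]; lra.
  + by rewrite min_l //; lra.
  + by rewrite min_r //; lra.
  + by rewrite min_l; [have -> : 2 * 0 + 0 = 0 :> R by lra|lra].
  + by rewrite min_r; [have -> : -2 * 1 + 2 = 0 :> R by lra|lra].
- by move=> t It /=.
move=> t It; rewrite /path_concat /path_rev /=; case: leP => ht.
  by rewrite min_l; [rewrite addr0|lra].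
by rewrite min_r; [congr f|]; lra.
Qed.

Lemma path_concat_revl x y f : is_path_to x [set y] f ->
  path_homotopic y [set y] (path_concat (path_rev f) f) (cst y).
Proof.
move=> /is_path_rev /path_concat_revr; apply: path_homotopic_eq => // t It.
by rewrite /path_concat; case: ifP => // _; rewrite /path_rev subKr.
Qed.
End homotopy.

Record path_to (R : realType) (X : topologicalType) (x : X) (A : set X) :=
  PathTo { path_fun :> R -> X; path_toP : is_path_to x A path_fun }.

HB.instance Definition _ (R : realType) (X : topologicalType) (x : X)
  (A : set X) := gen_eqMixin (path_to R x A).
HB.instance Definition _ (R : realType) (X : topologicalType) (x : X)
  (A : set X) := gen_choiceMixin (path_to R x A).

Section homotopy_class.
Context (R : realType) (X : topologicalType) (x : X) (A : set X).

Definition homotopic_rel (f g : path_to R x A) : bool :=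
  `[< path_homotopic x A f g >].

Lemma homotopic_rel_refl : reflexive homotopic_rel.
Proof. by move=> f; apply/asboolP/path_homotopic_refl/path_toP. Qed.

Lemma homotopic_rel_sym : symmetric homotopic_rel.
Proof.
by move=> f g; apply/asboolP/asboolP; exact: path_homotopic_sym.
Qed.

Lemma homotopic_rel_trans : transitive homotopic_rel.
Proof.
by move=> g f h /asboolP fg /asboolP gh;
  apply/asboolP; exact: path_homotopic_trans fg gh.
Qed.

Definition homotopic_equiv := EquivRel homotopic_rel
  homotopic_rel_refl homotopic_rel_sym homotopic_rel_trans.

Definition homotopy_class := {eq_quot homotopic_equiv}.
HB.instance Definition _ := Choice.on homotopy_class.
HB.instance Definition _ := Quotient.on homotopy_class.

Definition class_of (f : path_to R x A) : homotopy_class := \pi_homotopy_class f.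

Lemma class_of_eqP (f g : path_to R x A) :
  class_of f = class_of g <-> path_homotopic x A f g.
Proof.
split=> [/eqmodP/asboolP //|fg]; apply/eqmodP; exact/asboolP.
Qed.

Lemma class_of_repr (c : homotopy_class) : class_of (repr c) = c.
Proof. exact: reprK. Qed.

Lemma repr_class_of (f : path_to R x A) :
  path_homotopic x A (repr (class_of f)) f.
Proof. by apply/class_of_eqP; rewrite class_of_repr. Qed.
End homotopy_class.

Section fundamental_group.
Context (R : realType) (X : topologicalType) (x : X).

Definition pi1 : Type := homotopy_class R x [set x].
HB.instance Definition _ := Choice.on pi1.
HB.instance Definition _ := Quotient.on pi1.

Definition loop_one : path_to R x [set x] :=
  PathTo (@is_path_cst R X x [set x] erefl).
Definition loop_inv (f : path_to R x [set x]) : path_to R x [set x] :=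
  PathTo (is_path_rev (path_toP f)).
Definition loop_mul (f g : path_to R x [set x]) : path_to R x [set x] :=
  PathTo (is_path_concat (path_toP f) (path_toP g)).

Definition pi1_one : pi1 := class_of loop_one.
Definition pi1_inv (a : pi1) : pi1 := class_of (loop_inv (repr a)).
Definition pi1_mul (a b : pi1) : pi1 := class_of (loop_mul (repr a) (repr b)).

Lemma pi1_mulE f g :
  pi1_mul (class_of f) (class_of g) = class_of (loop_mul f g).
Proof.
by apply/class_of_eqP => /=; apply: path_homotopic_concat; exact: repr_class_of.
Qed.

Lemma pi1_invE f : pi1_inv (class_of f) = class_of (loop_inv f).
Proof. by apply/class_of_eqP/path_homotopic_rev/repr_class_of. Qed.

Lemma pi1_mulA : associative pi1_mul.
Proof.
move=> a b c; rewrite -(class_of_repr a) -(class_of_repr b) -(class_of_repr c).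
rewrite !pi1_mulE; apply/class_of_eqP.
by apply: path_concatA; exact: path_toP.
Qed.

Lemma pi1_mul1g : left_id pi1_one pi1_mul.
Proof.
move=> a; rewrite -(class_of_repr a) pi1_mulE; apply/class_of_eqP.
by apply: path_concat_cstl; exact: path_toP.
Qed.

Lemma pi1_mulg1 : right_id pi1_one pi1_mul.
Proof.
move=> a; rewrite -(class_of_repr a) pi1_mulE; apply/class_of_eqP.
by apply: path_concat_cstr; exact: path_toP.
Qed.

Lemma pi1_mulVg : left_inverse pi1_one pi1_inv pi1_mul.
Proof.
move=> a; rewrite -(class_of_repr a) pi1_invE pi1_mulE; apply/class_of_eqP.
by apply: path_concat_revl; exact: path_toP.
Qed.

Lemma pi1_mulgV : right_inverse pi1_one pi1_inv pi1_mul.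
Proof.
move=> a; rewrite -(class_of_repr a) pi1_invE pi1_mulE; apply/class_of_eqP.
by apply: path_concat_revr; exact: path_toP.
Qed.

HB.instance Definition _ := isGroup.Build pi1
  pi1_mulA pi1_mul1g pi1_mulg1 pi1_mulVg pi1_mulgV.
End fundamental_group.

Definition homeomorphism (X Y : topologicalType) (f : X -> Y) : Prop :=
  exists f' : Y -> X,
    [/\ cancel f f', cancel f' f, continuous f & continuous f'].

Record homeo_action (G : groupType) (X : topologicalType) := HomeoAction {
  hact :> G -> X -> X;
  hact1 : forall x, hact 1%g x = x;
  hactM : forall g h x, hact (g * h)%g x = hact g (hact h x);
  hact_homeo : forall g, homeomorphism (hact g)
}.

Definition orbit_of (G : groupType) (X : topologicalType)
    (act : homeo_action G X) (x : X) : set X := range (fun g => act g x).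

Definition weakly_discontinuous (R : realType) (G : groupType)
    (X : topologicalType) (act : homeo_action G X) (x : X) : Prop :=
  (forall g, act g x = x -> g = 1%g) /\
  path_component R (orbit_of act x) x = [set x].

Section orbit_group.
Context (R : realType) (G : groupType) (X : topologicalType).
Context (act : homeo_action G X) (x : X).
Context (wd : weakly_discontinuous R act x).
Local Notation Gx := (orbit_of act x).
Local Notation I := (unit_itv R).

Lemma hact_cont g : continuous (act g).
Proof. by have [? []] := hact_homeo act g. Qed.

Lemma hactK g : cancel (act g) (act g^-1%g).
Proof. by move=> z; rewrite -hactM mulVg hact1. Qed.

Lemma hactVK g : cancel (act g^-1%g) (act g).
Proof. by move=> z; rewrite -hactM mulgV hact1. Qed.

Lemma orbit_of_hact g z : Gx z -> Gx (act g z).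
Proof. by move=> [h _ <-]; exists (g * h)%g => //; rewrite hactM. Qed.

Lemma hact_inj_wd g h : act g x = act h x -> g = h.
Proof.
move=> gh; have := hactK h (act h x); rewrite -{1}gh -hactM => E.
have /wd.1 : act (h^-1 * g)%g x = x by rewrite hactM gh hactK.
by move/(congr1 (fun k => h * k)%g); rewrite mulVKg mulg1.
Qed.

Lemma within_hact g (T : topologicalType) (A : set T) (f : T -> X) :
  {within A, continuous f} -> {within A, continuous (act g \o f)}.
Proof.
move=> cf t.
by apply: (@continuous_comp (subspace A) X X f (act g) t (cf t)); exact: hact_cont.
Qed.

Lemma orbit_path_cst (f : R -> X) : {within I, continuous f} ->
  (forall t, I t -> Gx (f t)) -> forall t, I t -> f t = f 0.
Proof.
move=> cf fG t It.
have /fG[g _ gE] : I 0 by apply/unit_itvP; rewrite lexx ler01.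
have : path_component R Gx x (act g^-1%g (f t)).
  have It' s : I s -> I (t * s + 0).
    by move: It; rewrite !unit_itvP => /andP[? ?] /andP[? ?]; apply/andP; split; nra.
  exists (act g^-1%g \o (f \o (fun s => t * s + 0))); last first.
    by move=> _ [s Is <-] /=; apply/orbit_of_hact/fG/It'.
  split => /=.
  - apply: within_hact; apply: (within_comp _ It' cf).
    by apply: affine_cont => s; exact: cvg_id.
  - by rewrite mulr0 add0r -gE hactK.
  - by rewrite mulr1 addr0.
by rewrite wd.2 /= => /(congr1 (act g)); rewrite hactVK => ->.
Qed.

Lemma wd_homotopic (f g : R -> X) :
  path_homotopic x Gx f g -> path_homotopic x [set f 1] f g.
Proof.
move=> [F [cF F0 F1 Fx FA]]; exists F; split => // s Is /=.
have I0 : I 0 by apply/unit_itvP; rewrite lexx ler01.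
have I1 : I 1 by apply/unit_itvP; rewrite lexx ler01.
rewrite -F0 //; apply: (@orbit_path_cst (F \o (fun s => (1, s)))) => //.
apply: (within_comp _ _ cF) => [|t It]; last by [].
by apply: pair_cont => ?; [exact: cvg_cst|exact: cvg_id].
Qed.

Lemma path_homotopic_hact g y A f f' : @path_homotopic R X y A f f' ->
  path_homotopic (act g y) (act g @` A) (act g \o f) (act g \o f').
Proof.
move=> [F [cF F0 F1 Fx FA]]; exists (act g \o F); split => /=.
- exact: within_hact.
- by move=> t /F0 ->.
- by move=> t /F1 ->.
- by move=> t /Fx ->.
- by move=> t /FA; exists (F (1, t)).
Qed.

Lemma is_path_hact g y A f : @is_path_to R X y A f ->
  is_path_to (act g y) (act g @` A) (act g \o f).
Proof.
by move=> [cf <- fA]; split => //=; [exact: within_hact|exists (f 1)].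
Qed.

Definition path_end (f : path_to R x Gx) : G :=
  let: And3 _ _ fG := path_toP f in projT1 (cid2 fG).

Lemma path_endP (f : path_to R x Gx) : act (path_end f) x = f 1.
Proof.
by rewrite /path_end; case: (path_toP f) => _ _ fG; case: (cid2 fG).
Qed.

Lemma path_end_unique (f : path_to R x Gx) g : act g x = f 1 -> path_end f = g.
Proof. by rewrite -path_endP => /hact_inj_wd. Qed.

(* The hypothesis wd is a parameter: the group law is only defined for weakly
   discontinuous actions. *)
Definition pi1_orbit of weakly_discontinuous R act x : Type :=
  homotopy_class R x Gx.
Local Notation P := (pi1_orbit wd).
HB.instance Definition _ := Choice.on P.
HB.instance Definition _ := Quotient.on P.

Definition delta (a : P) : G := path_end (repr a).

Lemma deltaE (f : path_to R x Gx) : delta (class_of f : P) = path_end f.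
Proof.
have [F [_ _ F1 _ FA]] := wd_homotopic (repr_class_of f).
have I1 : I 1 by apply/unit_itvP; rewrite lexx ler01.
by apply: path_end_unique; rewrite path_endP -F1 // FA.
Qed.

Lemma is_path_orbit_one : @is_path_to R X x Gx (cst x).
Proof. by apply: is_path_cst; exists 1%g => //; rewrite hact1. Qed.

Lemma is_path_endP (f : path_to R x Gx) : is_path_to x [set act (path_end f) x] f.
Proof. by have [? ? _] := path_toP f; split => //=; rewrite path_endP. Qed.

Lemma is_path_orbit_mul (f g : path_to R x Gx) :
  is_path_to x Gx (path_concat f (act (path_end f) \o g)).
Proof.
apply: (is_path_concat (is_path_endP f)).
have [c g0 g1] := is_path_hact (path_end f) (path_toP g).
by split => //; case: g1 => z Gz <-; exact: orbit_of_hact.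
Qed.

Lemma is_path_orbit_inv (f : path_to R x Gx) :
  is_path_to x Gx (act (path_end f)^-1%g \o path_rev f).
Proof.
have [c g0 g1] := is_path_hact (path_end f)^-1%g (is_path_rev (is_path_endP f)).
split => //; first by rewrite g0 hactK.
by case: g1 => z /= -> <-; exists (path_end f)^-1%g.
Qed.

Definition orbit_one := PathTo is_path_orbit_one.
Definition orbit_mul (f g : path_to R x Gx) := PathTo (is_path_orbit_mul f g).
Definition orbit_inv (f : path_to R x Gx) := PathTo (is_path_orbit_inv f).

Lemma path_end_one : path_end orbit_one = 1%g.
Proof. by apply: path_end_unique; rewrite hact1. Qed.

Lemma path_end_mul f g : path_end (orbit_mul f g) = (path_end f * path_end g)%g.
Proof.
apply: path_end_unique; rewrite /= /path_concat ifF; last first.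
  by apply/negbTE; rewrite -ltNge; lra.
have -> : 2 * 1 - 1 = 1 :> R by lra.
  by rewrite /= -path_endP hactM.
Qed.

Lemma path_end_inv f : path_end (orbit_inv f) = (path_end f)^-1%g.
Proof.
apply: path_end_unique; rewrite /= /path_rev subrr.
by have [_ -> _] := path_toP f.
Qed.

Definition pi1_orbit_one : P := class_of orbit_one.
Definition pi1_orbit_mul (a b : P) : P := class_of (orbit_mul (repr a) (repr b)).
Definition pi1_orbit_inv (a : P) : P := class_of (orbit_inv (repr a)).

Lemma pi1_orbit_mulE f g :
  pi1_orbit_mul (class_of f) (class_of g) = class_of (orbit_mul f g).
Proof.
apply/class_of_eqP => /=; have := deltaE f; rewrite /delta => ->.
apply: path_homotopic_concat (act (path_end f) x) _ _ _ _ _ _ _.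
  have := wd_homotopic (repr_class_of f).
  by rewrite -path_endP; have := deltaE f; rewrite /delta => ->.
apply: path_homotopicS (path_homotopic_hact _ (repr_class_of g)).
by move=> _ [z Gz <-]; exact: orbit_of_hact.
Qed.

Lemma pi1_orbit_mulA : associative pi1_orbit_mul.
Proof.
move=> a b c; rewrite -(class_of_repr a) -(class_of_repr b) -(class_of_repr c).
move: (repr a) (repr b) (repr c) => f g h.
rewrite !pi1_orbit_mulE; apply/class_of_eqP; rewrite /= path_end_mul.
apply: (@path_homotopic_eq _ _ _ _
   (path_concat f (path_concat (act (path_end f) \o g)
      (act (path_end f * path_end g)%g \o h)))
   (path_concat (path_concat f (act (path_end f) \o g))
      (act (path_end f * path_end g)%g \o h))) => //.
  move=> t It; rewrite /path_concat /=; case: ifP => // _.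
  by case: ifP => // _; rewrite hactM.
apply: (path_concatA (is_path_endP f)).
- have [c' g0 g1] := is_path_hact (path_end f) (is_path_endP g).
  by split; [exact: c'|exact: g0|case: g1 => z /= -> <-; exact: erefl].
- have [c' h0 h1] := is_path_hact (path_end f * path_end g)%g (path_toP h).
  split; [exact: c'|by rewrite h0 hactM|].
  by case: h1 => z Gz <-; exact: orbit_of_hact.
Qed.

Lemma pi1_orbit_mul1g : left_id pi1_orbit_one pi1_orbit_mul.
Proof.
move=> a; rewrite -(class_of_repr a) pi1_orbit_mulE; apply/class_of_eqP.
rewrite /= path_end_one.
apply: path_homotopic_eq (path_concat_cstl (path_toP (repr a))) => // t It.
by rewrite /path_concat /=; case: ifP => // _; rewrite hact1.
Qed.

Lemma pi1_orbit_mulg1 : right_id pi1_orbit_one pi1_orbit_mul.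
Proof.
move=> a; rewrite -(class_of_repr a) pi1_orbit_mulE; apply/class_of_eqP => /=.
apply: path_homotopicS (path_concat_cstr (is_path_endP (repr a))).
by move=> z ->; exists (path_end (repr a)).
Qed.

Lemma pi1_orbit_invE f : pi1_orbit_inv (class_of f) = class_of (orbit_inv f).
Proof.
apply/class_of_eqP => /=; have := deltaE f; rewrite /delta => ->.
have := wd_homotopic (repr_class_of f).
rewrite -path_endP; have := deltaE f; rewrite /delta => ->.
move=> /path_homotopic_rev /(path_homotopic_hact (path_end f)^-1%g).
rewrite hactK; apply: path_homotopicS => _ [z /= -> <-].
by exists (path_end f)^-1%g.
Qed.

Lemma pi1_orbit_mulVg : left_inverse pi1_orbit_one pi1_orbit_inv pi1_orbit_mul.
Proof.
move=> a; rewrite -(class_of_repr a); move: (repr a) => f.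
rewrite pi1_orbit_invE pi1_orbit_mulE; apply/class_of_eqP.
rewrite /= path_end_inv.
have := path_homotopic_hact (path_end f)^-1%g
  (path_concat_revl (is_path_endP f)).
rewrite hactK => H; apply: path_homotopicS; last first.
  apply: path_homotopic_eq H => t It /=; last by rewrite hactK.
  by rewrite /path_concat; case: ifP.
by move=> _ [z /= -> <-]; rewrite hactK; exists 1%g; rewrite ?hact1.
Qed.

Lemma pi1_orbit_mulgV : right_inverse pi1_orbit_one pi1_orbit_inv pi1_orbit_mul.
Proof.
move=> a; rewrite -(class_of_repr a); move: (repr a) => f.
rewrite pi1_orbit_invE pi1_orbit_mulE; apply/class_of_eqP => /=.
apply: (@path_homotopicS _ _ _ [set x]).
  by move=> _ ->; exists 1%g; rewrite ?hact1.
apply: path_homotopic_eq (path_concat_revr (is_path_endP f)) => // t It.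
by rewrite /path_concat; case: ifP => //= _; rewrite hactVK.
Qed.

HB.instance Definition _ := isGroup.Build P pi1_orbit_mulA
  pi1_orbit_mul1g pi1_orbit_mulg1 pi1_orbit_mulVg pi1_orbit_mulgV.

Lemma delta_morph : monoid.monoid_morphism delta.
Proof.
split=> [|a b]; first by rewrite deltaE path_end_one.
by rewrite [LHS]deltaE path_end_mul.
Qed.

HB.instance Definition _ := monoid.isUMagmaMorphism.Build P G delta delta_morph.

Lemma is_path_orbit_of_loop (f : path_to R x [set x]) : is_path_to x Gx f.
Proof.
have [? ? f1] := path_toP f; split => //; exists 1%g => //.
by rewrite hact1; exact/esym/f1.
Qed.

Definition orbit_of_loop (f : path_to R x [set x]) : path_to R x Gx :=
  PathTo (is_path_orbit_of_loop f).

Definition jmap (a : pi1 R x) : P := class_of (orbit_of_loop (repr a)).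

Lemma jmapE (f : path_to R x [set x]) :
  jmap (class_of f) = class_of (orbit_of_loop f).
Proof.
apply/class_of_eqP; apply: path_homotopicS (repr_class_of f).
by move=> _ ->; exists 1%g; rewrite ?hact1.
Qed.
End orbit_group.

Arguments pi1 R {X} x.
Arguments pi1_orbit {R G X act x} wd.
Arguments delta {R G X act x} wd a.
Arguments jmap {R G X act x} wd a.

(* The homomorphism d is a parameter of the type because the group law depends
   on it. *)
Definition wreath (S : finGroupType) (G K : groupType)
  of monoid.UMagmaMorphism.type K S : Type := ({ffun S -> G} * K)%type.
Arguments wreath {S} G {K} d.

Section wreath.
Context (S : finGroupType) (G K : groupType) (d : monoid.UMagmaMorphism.type K S).
Local Notation W := (wreath G d).
Local Open Scope group_scope.

HB.instance Definition _ := Choice.on W.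

Definition wreath_one : W := ([ffun=> 1], 1).
Definition wreath_mul (u v : W) : W :=
  ([ffun h => u.1 h * v.1 (h * d u.2)], u.2 * v.2).
Definition wreath_inv (u : W) : W :=
  ([ffun h => (u.1 (h * (d u.2)^-1))^-1], u.2^-1).

Lemma wreath_mulA : associative wreath_mul.
Proof.
move=> u v t; congr pair; last by rewrite /= mulgA.
by apply/ffunP => h; rewrite !ffunE /= gmulfM !mulgA.
Qed.

Lemma wreath_mul1g : left_id wreath_one wreath_mul.
Proof.
case=> a k; congr pair; last by rewrite /= mul1g.
by apply/ffunP => h; rewrite !ffunE /= gmulf1 mulg1 mul1g.
Qed.

Lemma wreath_mulg1 : right_id wreath_one wreath_mul.
Proof.
case=> a k; congr pair; last by rewrite /= mulg1.
by apply/ffunP => h; rewrite !ffunE mulg1.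
Qed.

Lemma wreath_mulVg : left_inverse wreath_one wreath_inv wreath_mul.
Proof.
case=> a k; congr pair; last by rewrite /= mulVg.
by apply/ffunP => h; rewrite !ffunE /= gmulfV mulVg.
Qed.

Lemma wreath_mulgV : right_inverse wreath_one wreath_inv wreath_mul.
Proof.
case=> a k; congr pair; last by rewrite /= mulgV.
by apply/ffunP => h; rewrite !ffunE /= mulgK mulgV.
Qed.

HB.instance Definition _ := isGroup.Build W
  wreath_mulA wreath_mul1g wreath_mulg1 wreath_mulVg wreath_mulgV.
End wreath.

Definition wreath_id (G : groupType) (H : finGroupType) : groupType :=
  wreath G (@idfun H : monoid.UMagmaMorphism.type H H).

Definition wreath_map (A G K : groupType) (H : finGroupType) (p : A -> G)
    (d : monoid.UMagmaMorphism.type K H) (u : wreath A d) : wreath_id G H :=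
  ([ffun h => p (u.1 h)], d u.2).

(* Map(H, A), which is A^m after enumerating H, is {ffun H -> A}. *)
Definition wreath_incl (A B A' K : groupType) (H : finGroupType)
    (d : monoid.UMagmaMorphism.type K H) (i : A -> A') (j : B -> K)
    (u : {ffun H -> A} * B) : wreath A' d :=
  ([ffun h => i (u.1 h)], j u.2).

Arguments wreath_map {A G K H} p d u.
Arguments wreath_incl {A B A' K H} d i j u.

Section wreath_action.
Context (G : groupType) (H : finGroupType) (X Y : topologicalType).
Context (actX : homeo_action G X) (actY : homeo_action H Y).

Definition wreath_act_fun (u : wreath_id G H) (p : {ptws H -> X} * Y) :
    {ptws H -> X} * Y :=
  ((fun k => actX (u.1 k) (p.1 (k * u.2)%g)), actY u.2 p.2).

Lemma wreath_act1 p : wreath_act_fun 1%g p = p.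
Proof.
case: p => a y; congr pair; last exact: hact1.
by apply/funext => k; rewrite ffunE hact1 mulg1.
Qed.

Lemma wreath_actM u v p :
  wreath_act_fun (u * v)%g p = wreath_act_fun u (wreath_act_fun v p).
Proof.
case: p => a y; congr pair; last exact: hactM.
by apply/funext => k; rewrite ffunE hactM /= mulgA.
Qed.

Lemma wreath_act_cont u : continuous (wreath_act_fun u).
Proof.
apply: pair_cont => p; last first.
  by apply: (@continuous_comp _ _ _ snd (actY u.2));
    [exact: cvg_snd|exact: hact_cont].
apply/cvg_sup => k; apply: (@continuous_comp_initial _ _ _ (fun f => f k)).
move=> {}p; apply: (@continuous_comp _ _ _
  (fun q : {ptws H -> X} * Y => q.1 (k * u.2)%g) (actX (u.1 k))); last first.
  exact: hact_cont.
apply: (@continuous_comp _ _ _ fst (fun f : {ptws H -> X} => f (k * u.2)%g)).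
  exact: cvg_fst.
exact: (@proj_continuous H (fun=> X) (k * u.2)%g).
Qed.

Lemma wreath_act_homeo u : homeomorphism (wreath_act_fun u).
Proof.
exists (wreath_act_fun u^-1%g); split; try exact: wreath_act_cont.
  by move=> p; rewrite -wreath_actM mulVg wreath_act1.
by move=> p; rewrite -wreath_actM mulgV wreath_act1.
Qed.

Definition wreath_act := HomeoAction wreath_act1 wreath_actM wreath_act_homeo.

Definition wreath_base (x : X) (y : Y) : {ptws H -> X} * Y := (fun=> x, y).
End wreath_action.
Arguments wreath_base H {X Y} x y.

Local Open Scope group_scope.

Definition short_exact (A B C : groupType) (i : A -> B) (p : B -> C) : Prop :=
  [/\ monoid.monoid_morphism i, monoid.monoid_morphism p, injective i,
      forall b, p b = 1 <-> exists a, i a = b & forall c, exists b, p b = c].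

Definition is_group_iso (A B : groupType) (f : A -> B) : Prop :=
  monoid.monoid_morphism f /\ bijective f.

Definition isomorphic_groups (A B : groupType) : Prop :=
  exists f : A -> B, is_group_iso f.

Definition isomorphic_ses (A B C A' B' C' : groupType)
    (i : A -> B) (p : B -> C) (i' : A' -> B') (p' : B' -> C') : Prop :=
  exists (fA : A -> A') (fB : B -> B') (fC : C -> C'),
    [/\ is_group_iso fA, is_group_iso fB, is_group_iso fC,
        forall a, fB (i a) = i' (fA a) & forall b, fC (p b) = p' (fB b)].

(* Main.v *)
Require Import Defs.
From mathcomp Require Import all_boot all_order all_algebra all_fingroup.
From mathcomp Require Import all_classical all_reals all_analysis.
From mathcomp Require Import generic_quotient.

Set SsrOldRewriteGoalsOrder.
Set Implicit Arguments.
Unset Strict Implicit.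
Unset Printing Implicit Defensive.

Local Open Scope classical_set_scope.
Local Open Scope ring_scope.

(** A path in W = Map(H, X) x Y is the same thing as a family of paths in X
indexed by H together with a path in Y, and the same holds for homotopies,
because W carries the product topology (within_continuous_pair). The orbit of
w = (constant map x, y) is the product of orbits Map(H, Gx) x Hy
(orbit_wreathE): the components phi(k) of an element (phi, h) of the wreath
product can be chosen independently. So the end condition on paths is a product
condition too, and sending a class to the family of classes of its components
is a bijection
  pi_1(W, (G wr H)w, w) -> Map(H, pi_1(X, Gx, x)) x pi_1(Y, Hy, y)
(class_split_bij); applied to the target set {w} instead of the orbit, the same
fact gives pi_1(W, w) -> Map(H, pi_1(X, x)) x pi_1(Y, y).

The bijection is multiplicative because the translate of a path (beta, g) by
(phi, h) has k-th component phi(k) beta(kh). In the product of two classes, the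
k-th component of the second one is therefore taken at k h, where h is the end
of the Y-component of the first: this is the multiplication of the wreath
product along delta_Y (pi1_orbit_split_iso). Compatibility with j and delta can
be read off on representatives, with the identity on G wr H.

Weak discontinuity of W follows since the components of a path in the orbit of
w are paths in Gx and Hy. Exactness of the sequence of any weakly discontinuous
action on a path connected space is proved once (short_exact_orbit) and used
for X, Y and W; exactness passes from X and Y to the wreath product
algebraically (short_exact_wreath). *)

(** * Continuity of maps into Map(I, X) x Y *)

Section function_space.
Context {I : choiceType} {X Y : topologicalType}.
Local Notation W := ({ptws I -> X} * Y)%type.

Lemma coord_continuous (k : I) : continuous (fun p : W => p.1 k).
Proof.
move=> p; apply: (@continuous_comp _ _ _ fst (fun f : {ptws I -> X} => f k)).
  exact: cvg_fst.
exact: (@proj_continuous I (fun=> X) k).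
Qed.

Lemma within_continuous_coord (T : topologicalType) (D : set T) (f : T -> W) k :
  {within D, continuous f} -> {within D, continuous (fun t => (f t).1 k)}.
Proof.
move=> cf t; apply: (@continuous_comp (subspace D) W X f (fun p => p.1 k)).
  exact: cf.
exact: coord_continuous.
Qed.

Lemma within_continuous_snd (T : topologicalType) (D : set T) (f : T -> W) :
  {within D, continuous f} -> {within D, continuous (fun t => (f t).2)}.
Proof.
move=> cf t; apply: (@continuous_comp (subspace D) W Y f snd).
  exact: cf.
exact (@snd_cont _ _ _).
Qed.

(** The universal property of the product topology, relative to a subset. *)
Lemma within_continuous_pair (T : topologicalType) (D : set T)
    (f : I -> T -> X) (g : T -> Y) :
  (forall k, {within D, continuous (f k)}) -> {within D, continuous g} ->
  {within D, continuous (fun t => (f ^~ t, g t) : W)}.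
Proof.
move=> cf cg; apply: (@pair_cont (subspace D) {ptws I -> X}) => // t.
apply/cvg_sup => k.
have initc := @continuous_comp_initial {ptws I -> X} (subspace D) X
  (fun f => f k) (fun (t : subspace D) k => f k t).
by apply: (initc _ t); exact: cf.
Qed.

End function_space.

(** * Homotopy classes of paths in Map(I, X) x Y *)

Lemma eq_class_of (R : realType) (X : topologicalType) (x : X) (A : set X)
    (f g : path_to R x A) :
  (forall t, unit_itv R t -> f t = g t) -> class_of f = class_of g.
Proof.
move=> fg; apply/class_of_eqP; apply: path_homotopic_eq (path_homotopic_refl _).
- by move=> t _; reflexivity.
- exact: fg.
- exact: path_toP.
Qed.

Section product_paths.
Context {R : realType} {I : finType} {X Y : topologicalType}.
(* The set C of end points is tied to A and B by the hypothesis CE rather than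
   defined from them, so that the results apply as they stand to homotopy
   classes with ends in an orbit or in a singleton. *)
Context {x : X} {y : Y} {A : set X} {B : set Y} {C : set ({ptws I -> X} * Y)}.
Local Notation W := ({ptws I -> X} * Y)%type.
Local Notation w := ((fun=> x, y) : W).
Hypothesis CE : forall p : W, C p <-> (forall k, A (p.1 k)) /\ B p.2.

Lemma is_path_coord (f : R -> W) k :
  is_path_to w C f -> is_path_to x A (fun t => (f t).1 k).
Proof.
move=> [cf f0 /CE[fA _]]; split => //; last by rewrite f0.
exact: within_continuous_coord cf.
Qed.

Lemma is_path_snd (f : R -> W) :
  is_path_to w C f -> is_path_to y B (fun t => (f t).2).
Proof.
move=> [cf f0 /CE[_ fB]]; split => //; last by rewrite f0.
exact: within_continuous_snd cf.
Qed.

Lemma is_path_pair (f : I -> R -> X) (g : R -> Y) :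
  (forall k, is_path_to x A (f k)) -> is_path_to y B g ->
  is_path_to w C (fun t => (f ^~ t, g t)).
Proof.
move=> pf [cg g0 gB]; split.
- by apply: within_continuous_pair cg => k; have [] := pf k.
- by rewrite g0; congr pair; apply/funext => k; have [] := pf k.
- by apply/CE; split=> // k; have [] := pf k.
Qed.

(** A homotopy in the product is a family of homotopies in the factors; from
right to left the homotopies in X are chosen, one for each index, and any
choice is continuous jointly in the product topology. *)
Lemma path_homotopic_pairE (f g : R -> W) :
  path_homotopic w C f g <->
  (forall k, path_homotopic x A (fun t => (f t).1 k) (fun t => (g t).1 k)) /\
  path_homotopic y B (fun t => (f t).2) (fun t => (g t).2).
Proof.
split=> [[F [cF F0 F1 Fw FC]]|[/boolp.choice[F FP] [K [cK K0 K1 Ky KB]]]].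
  split=> [k|].
    exists (fun u => (F u).1 k); split.
    - exact: within_continuous_coord cF.
    - by move=> t /F0 ->.
    - by move=> t /F1 ->.
    - by move=> s /Fw ->.
    - by move=> s /FC /CE[].
  exists (fun u => (F u).2); split.
  - exact: within_continuous_snd cF.
  - by move=> t /F0 ->.
  - by move=> t /F1 ->.
  - by move=> s /Fw ->.
  - by move=> s /FC /CE[].
exists (fun u => (F ^~ u, K u)); split.
- by apply: within_continuous_pair cK => k; have [] := FP k.
- move=> t It; rewrite K0 // [RHS]surjective_pairing; congr pair.
  by apply/funext => k; have [_ -> //] := FP k.
- move=> t It; rewrite K1 // [RHS]surjective_pairing; congr pair.
  by apply/funext => k; have [_ _ -> //] := FP k.
- move=> s Is; rewrite Ky //; congr pair.
  by apply/funext => k; have [_ _ _ -> //] := FP k.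
- by move=> s Is; apply/CE; split=> [k|]; [have [_ _ _ _] := FP k; apply|exact: KB].
Qed.

Definition coord_path k (f : path_to R w C) : path_to R x A :=
  PathTo (is_path_coord k (path_toP f)).
Definition snd_path (f : path_to R w C) : path_to R y B :=
  PathTo (is_path_snd (path_toP f)).
Definition pair_path (f : I -> path_to R x A) (g : path_to R y B) :
    path_to R w C :=
  PathTo (is_path_pair (fun k => path_toP (f k)) (path_toP g)).

Definition class_split (c : homotopy_class R w C) :
    {ffun I -> homotopy_class R x A} * homotopy_class R y B :=
  ([ffun k => class_of (coord_path k (repr c))], class_of (snd_path (repr c))).

Lemma class_splitE f : class_split (class_of f) =
  ([ffun k => class_of (coord_path k f)], class_of (snd_path f)).
Proof.
have /path_homotopic_pairE[Hx Hy] := repr_class_of f.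
congr pair; last exact/class_of_eqP.
by apply/ffunP => k; rewrite !ffunE; apply/class_of_eqP; exact: Hx.
Qed.

Lemma class_split_bij : bijective class_split.
Proof.
exists (fun c : {ffun I -> homotopy_class R x A} * homotopy_class R y B =>
  class_of (pair_path (fun k => repr (c.1 k)) (repr c.2))).
  move=> c; rewrite -[RHS]class_of_repr.
  apply/class_of_eqP/path_homotopic_pairE; split=> [k|] /=.
    by rewrite ffunE; exact: repr_class_of.
  exact: repr_class_of.
move=> [a b]; rewrite class_splitE; congr pair.
  apply/ffunP => k; rewrite ffunE -[RHS]class_of_repr.
  by apply/class_of_eqP/path_homotopic_refl/path_toP.
rewrite -[RHS]class_of_repr.
by apply/class_of_eqP/path_homotopic_refl/path_toP.
Qed.

End product_paths.

Lemma path_connected_pair (R : realType) (I : finType) (X Y : topologicalType) :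
  path_connected R X -> path_connected R Y ->
  path_connected R ({ptws I -> X} * Y)%type.
Proof.
move=> pcX pcY [a b] [a' b'].
have [g [cg g0 g1]] := pcY b b'.
have /boolp.choice[f fP] : forall k, exists f : R -> X, is_path_to (a k) [set a' k] f.
  by move=> k; exact: pcX.
exists (fun t : R => (f ^~ t, g t)); split.
- by apply: within_continuous_pair cg => k; have [] := fP k.
- by rewrite g0; congr pair; apply/funext => k; have [] := fP k.
- by rewrite g1; congr pair; apply/funext => k; have [] := fP k.
Qed.

(** * The short exact sequence of a weakly discontinuous action *)

Section orbit_sequence.
Context {R : realType} {G : groupType} {X : topologicalType}.
Context {act : homeo_action G X} {x : X}.
Context (wd : weakly_discontinuous R act x).
Local Open Scope group_scope.

Lemma path_end_orbit_of_loop (f : path_to R x [set x]) :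
  path_end (orbit_of_loop act f) = 1.
Proof.
apply: (path_end_unique wd); have [_ _ /= ->] := path_toP f.
by rewrite hact1.
Qed.

(** A loop ends at 1 x, so in the product of two loops the second one is
translated by 1, and the product is plain concatenation. *)
Lemma jmap_morph : monoid.monoid_morphism (jmap wd).
Proof.
split=> [|a b].
  rewrite [LHS](jmapE wd (loop_one R x)).
  exact: eq_class_of.
rewrite -(class_of_repr a) -(class_of_repr b); move: (repr a) (repr b) => f g.
rewrite [X in jmap wd X](pi1_mulE f g) !jmapE.
rewrite [RHS](pi1_orbit_mulE wd (orbit_of_loop act f) (orbit_of_loop act g)).
apply: eq_class_of => t It /=.
rewrite path_end_orbit_of_loop /path_concat /=.
by case: ifP => // _; rewrite hact1.
Qed.

(** This is where weak discontinuity is essential: in a homotopy through paths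
ending in the orbit, the end point runs along a path in the orbit, which is
constant, so that a homotopy between loops is a homotopy of loops. *)
Lemma jmap_inj : injective (jmap wd).
Proof.
move=> a b; rewrite -(class_of_repr a) -(class_of_repr b).
move: (repr a) (repr b) => f g; rewrite !jmapE => /class_of_eqP.
move=> /(wd_homotopic wd) fg; apply/class_of_eqP.
by apply: path_homotopicS fg => z /= ->; have [_ _] := path_toP f.
Qed.

(** Path connectedness gives surjectivity of delta: any path from x to g x is
a preimage of g. A class in the kernel of delta is represented by a path ending
at 1 x = x, that is, by a loop. *)
Lemma short_exact_orbit : path_connected R X -> short_exact (jmap wd) (delta wd).
Proof.
move=> pcX; split.
- exact: jmap_morph.
- exact: delta_morph.
- exact: jmap_inj.
- move=> b; split=> [|[a <-]]; last first.
    by rewrite -(class_of_repr a) jmapE deltaE path_end_orbit_of_loop.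
  rewrite -(class_of_repr b) deltaE => b1.
  have pb : is_path_to x [set x] (repr b).
    have [cb b0 _] := path_toP (repr b); split => //=.
    by rewrite -path_endP b1 hact1.
  exists (class_of (PathTo pb)); rewrite jmapE.
  exact: eq_class_of.
- move=> g; have [f [cf f0 f1]] := pcX x (act g x).
  have pf : is_path_to x (orbit_of act x) f by split => //; exists g.
  exists (class_of (PathTo pf)); rewrite deltaE.
  by apply: (path_end_unique wd); rewrite /= f1.
Qed.

End orbit_sequence.

(** * Exactness of the wreath product of two short exact sequences *)

Section wreath_sequence.
Context {A A' B K G : groupType} {H : finGroupType}.
Context (d : monoid.UMagmaMorphism.type K H).
Local Open Scope group_scope.

(** On the image of j the homomorphism d is trivial, so the twist in the wreath
product disappears there and the inclusion of the direct product is a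
homomorphism. Everything else holds componentwise, because the projection only
involves d on the second factor. *)
Lemma short_exact_wreath (i : A -> A') (p : A' -> G) (j : B -> K) :
  short_exact i p -> short_exact j d ->
  short_exact (wreath_incl d i j) (wreath_map p d).
Proof.
move=> [[i1 iM] [p1 pM] i_inj ip p_surj] [[j1 jM] [d1 dM] j_inj jd d_surj].
have dj b : d (j b) = 1 by apply/jd; exists b.
split.
- split=> [|u v]; congr pair => //=.
    by apply/ffunP => h; rewrite !ffunE.
  by apply/ffunP => h; rewrite !ffunE /= dj mulg1 iM.
- split=> [|u v]; congr pair => //=.
    by apply/ffunP => h; rewrite !ffunE.
  by apply/ffunP => h; rewrite !ffunE pM.
- move=> [a b] [a' b'] [/ffunP ai /j_inj ->]; congr pair.
  by apply/ffunP => h; have := ai h; rewrite !ffunE => /i_inj.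
- move=> [u k]; split=> [[/ffunP pu dk]|[[a b] [<- <-]]].
    have /boolp.choice[a aE] h : exists a, i a = u h.
      by apply/ip; have := pu h; rewrite !ffunE.
    have /jd[b <-] := dk.
    exists ([ffun h => a h], b); congr pair.
    by apply/ffunP => h; rewrite !ffunE aE.
  congr pair; last exact: dj.
  by apply/ffunP => h; rewrite !ffunE; apply/ip; exists (a h).
- move=> [c h]; have [k <-] := d_surj h.
  have /boolp.choice[u uE] := fun h => p_surj (c h).
  exists ([ffun h => u h], k); congr pair.
  by apply/ffunP => h'; rewrite !ffunE uE.
Qed.

End wreath_sequence.

(** * The action of the wreath product on Map(H, X) x Y *)

Section wreath_orbit.
Context {R : realType} {X Y : topologicalType} {G : groupType}.
Context {H : finGroupType} {actX : homeo_action G X} {actY : homeo_action H Y}.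
Context {x : X} {y : Y}.
Local Notation actW := (wreath_act actX actY).
Local Notation w := (wreath_base H x y).
Local Open Scope group_scope.

(** The base point has a constant first component, so right translation by h
does not move it and (phi, h) sends it to (k |-> phi(k) x, h y). *)
Lemma orbit_wreathE (p : {ptws H -> X} * Y) : orbit_of actW w p <->
  (forall k, orbit_of actX x (p.1 k)) /\ orbit_of actY y p.2.
Proof.
split=> [[[a h] _ <-]|[]]; first by split=> [k|]; [exists (a k)|exists h].
case: p => p q /= /(_ _)/cid2 px [h _ <-].
exists ([ffun k => projT1 (px k)], h) => //; congr pair.
by apply/funext => k; rewrite ffunE; case: (px k).
Qed.

Lemma base_wreathE (p : {ptws H -> X} * Y) :
  [set w] p <-> (forall k, [set x] (p.1 k)) /\ [set y] p.2.
Proof.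
split=> [->//|]; case: p => p q /= [px ->].
by congr pair; apply/funext.
Qed.

Context (wdX : weakly_discontinuous R actX x).
Context (wdY : weakly_discontinuous R actY y).

(** The components of a path in the orbit of w are paths in Gx and Hy, hence end
where they start. *)
Lemma wreath_weakly_discontinuous : weakly_discontinuous R actW w.
Proof.
split=> [[a h] [ax hy]|].
  congr pair; last exact: wdY.1.
  by apply/ffunP => k; rewrite ffunE; apply: wdX.1; exact: (congr1 (@^~ k) ax).
apply/seteqP; split=> [p [f pf fO]|_ ->]; last first.
  exists (cst w); first exact: is_path_cst.
  by move=> _ [t _ <-]; exists 1; rewrite ?hact1.
have [cf f0 f1] := pf.
have fO' t : unit_itv R t -> orbit_of actW w (f t) by move=> It; apply: fO; exists t.
apply/base_wreathE; split=> [k|].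
  rewrite -wdX.2; exists (fun t => (f t).1 k).
    split; last by rewrite f1.
      exact: within_continuous_coord cf.
    by rewrite f0.
  by move=> _ [t /fO' /orbit_wreathE[+ _] <-]; exact.
rewrite -wdY.2; exists (fun t => (f t).2).
  split; last by rewrite f1.
    exact: within_continuous_snd cf.
  by rewrite f0.
by move=> _ [t /fO' /orbit_wreathE[_ +] <-].
Qed.

Context (wdW : weakly_discontinuous R actW w).

Definition pi1_split : pi1 R w -> {ffun H -> pi1 R x} * pi1 R y :=
  class_split base_wreathE.

Definition pi1_orbit_split :
    pi1_orbit wdW -> wreath (pi1_orbit wdX) (delta wdY) :=
  class_split orbit_wreathE.

Lemma path_end_wreath (f : path_to R w (orbit_of actW w)) : path_end f =
  ([ffun k => path_end (coord_path orbit_wreathE k f)],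
   path_end (snd_path orbit_wreathE f)).
Proof.
apply: (path_end_unique wdW); rewrite [RHS]surjective_pairing; congr pair.
  by apply/funext => k; rewrite /= ffunE path_endP.
by rewrite /= path_endP.
Qed.

Lemma pi1_split_iso : is_group_iso pi1_split.
Proof.
split; last exact: class_split_bij.
split=> [|a b].
  rewrite [LHS](class_splitE base_wreathE (loop_one R w)); congr pair.
    by apply/ffunP => k; rewrite !ffunE; exact: eq_class_of.
  exact: eq_class_of.
rewrite -(class_of_repr a) -(class_of_repr b); move: (repr a) (repr b) => f g.
rewrite [X in pi1_split X](pi1_mulE f g) /pi1_split !class_splitE.
congr pair.
  apply/ffunP => k; rewrite !ffunE [RHS]pi1_mulE.
  apply: eq_class_of => t It /=.
  by rewrite /path_concat; case: ifP.
rewrite [RHS]pi1_mulE; apply: eq_class_of => t It /=.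
by rewrite /path_concat; case: ifP.
Qed.

(** By path_end_wreath, a product path in W concatenates the k-th component of
f with the (k h)-th component of g translated by the end of the former, where h
is the end of the Y-component of f. This is the product of the two classes in
the wreath product along delta_Y. *)
Lemma pi1_orbit_split_iso : is_group_iso pi1_orbit_split.
Proof.
split; last exact: class_split_bij.
split=> [|a b].
  rewrite [LHS](class_splitE orbit_wreathE (orbit_one R actW w)); congr pair.
    by apply/ffunP => k; rewrite !ffunE; exact: eq_class_of.
  exact: eq_class_of.
rewrite -(class_of_repr a) -(class_of_repr b); move: (repr a) (repr b) => f g.
rewrite [X in pi1_orbit_split X](pi1_orbit_mulE wdW f g).
rewrite /pi1_orbit_split !class_splitE; congr pair.
  apply/ffunP => k; rewrite !ffunE /=.
  rewrite (deltaE wdY (snd_path orbit_wreathE f)) [RHS]pi1_orbit_mulE.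
  apply: eq_class_of => t It /=.
  by rewrite /path_concat path_end_wreath; case: ifP => //= _; rewrite ffunE.
rewrite [RHS]pi1_orbit_mulE; apply: eq_class_of => t It /=.
by rewrite /path_concat path_end_wreath; case: ifP.
Qed.

Lemma pi1_orbit_split_jmap a : pi1_orbit_split (jmap wdW a) =
  wreath_incl (delta wdY) (jmap wdX) (jmap wdY) (pi1_split a).
Proof.
rewrite -(class_of_repr a) jmapE /pi1_split /pi1_orbit_split !class_splitE.
congr pair.
  by apply/ffunP => k; rewrite !ffunE jmapE; exact: eq_class_of.
by rewrite jmapE; exact: eq_class_of.
Qed.

Lemma delta_pi1_orbit_split b :
  delta wdW b = wreath_map (delta wdX) (delta wdY) (pi1_orbit_split b).
Proof.
rewrite -(class_of_repr b) deltaE path_end_wreath /pi1_orbit_split class_splitE.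
congr pair; last by rewrite /= deltaE.
by apply/ffunP => k; rewrite !ffunE deltaE.
Qed.

End wreath_orbit.

Theorem theorem4p2p1 (R : realType) (X Y : topologicalType)
    (G : groupType) (H : finGroupType)
    (actX : homeo_action G X) (actY : homeo_action H Y) (x : X) (y : Y)
    (pcX : path_connected R X) (pcY : path_connected R Y)
    (wdX : weakly_discontinuous R actX x)
    (wdY : weakly_discontinuous R actY y) :
  exists wdW : weakly_discontinuous R (wreath_act actX actY) (wreath_base H x y),
    let jW : pi1 R (wreath_base H x y) -> pi1_orbit wdW := jmap wdW in
    let deltaW : pi1_orbit wdW -> wreath_id G H := delta wdW in
    let jXY : ({ffun H -> pi1 R x} * pi1 R y)%type ->
              wreath (pi1_orbit wdX) (delta wdY) :=
      wreath_incl (delta wdY) (jmap wdX) (jmap wdY) in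
    let deltaXY : wreath (pi1_orbit wdX) (delta wdY) -> wreath_id G H :=
      wreath_map (delta wdX) (delta wdY) in
    [/\ short_exact jW deltaW,
        short_exact jXY deltaXY,
        isomorphic_ses jW deltaW jXY deltaXY &
        isomorphic_groups (pi1_orbit wdW)
                          (wreath (pi1_orbit wdX) (delta wdY))].
Proof.
exists (wreath_weakly_discontinuous wdX wdY) => jW deltaW jXY deltaXY.
pose splitW := @pi1_orbit_split _ _ _ _ _ _ _ _ _ wdX wdY
  (wreath_weakly_discontinuous wdX wdY).
split.
- by apply: short_exact_orbit; exact: path_connected_pair.
- by apply: short_exact_wreath; exact: short_exact_orbit.
- exists pi1_split, splitW, idfun; split.
  + exact: pi1_split_iso.
  + exact: pi1_orbit_split_iso.
  + by split; [split|exists idfun].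
  + exact: pi1_orbit_split_jmap.
  + exact: delta_pi1_orbit_split.
- by exists splitW; exact: pi1_orbit_split_iso.
Qed.
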